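(* Let $n\ge1$ and $s\in(0,1)$. There is a constant $C=C(n,s)>0$, depending only on $n$ and $s$, such that the following holds. Let $a:\mathbb{R}^n\to\mathbb{R}$ be a nonnegative function with $a\in L^1_{loc}(\mathbb{R}^n)$ and let $u\in H^s(\mathbb{R}^n)$ satisfy $$\int_{\mathbb{R}^n}\int_{\mathbb{R}^n}\frac{(u(x)-u(y))(v(x)-v(y))}{|x-y|^{n+2s}}dxdy+\int_{\mathbb{R}^n}a(x)u(x)v(x)\,dx\ge0$$ for all $v\in H^s(\mathbb{R}^n)$ with $v\ge0$ almost everywhere. Then for all $r,d>0$ and $x_0\in\mathbb{R}^n$, $$\int_{B_r}\int_{B_r}\left|\log\left(\frac{d+u(x)}{d+u(y)}\right)\right|^2\frac{1}{|x-y|^{n+2s}}dxdy\le Cr^{n-2s}+\int_{B_{2r}}a(x)\,dx,$$ where $B_r=B_r(x_0)$ and $B_{2r}=B_{2r}(x_0)$.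
   Context: Functions are real-valued. $H^s(\mathbb{R}^n)$ is the space of $u\in L^2(\mathbb{R}^n)$ with $\int_{\mathbb{R}^n}\int_{\mathbb{R}^n}\frac{(u(x)-u(y))^2}{|x-y|^{n+2s}}dxdy<\infty$. $B_\rho(x_0)$ is the ball of radius $\rho$ centered at $x_0$. The hypothesis is understood to include that, for each such $v$, the integral $\int_{\mathbb{R}^n}a u v\,dx$ is well defined (as an element of $[-\infty,+\infty]$). Under the hypotheses one has $u\ge0$ almost everywhere, so the logarithm is defined almost everywhere. *)

(* Defs.v *)
From HB Require Import structures.
From mathcomp Require Import all_boot all_order all_algebra.
From mathcomp Require Import all_classical all_reals all_analysis.
From mathcomp Require Import measurable_realfun.

Set Implicit Arguments.
Unset Strict Implicit.
Unset Printing Implicit Defensive.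

Import Order.TTheory GRing.Theory Num.Theory.
Import numFieldNormedType.Exports.

Local Open Scope classical_set_scope.
Local Open Scope ring_scope.

Definition measure_rV_display : measure_display -> measure_display.
Proof. exact. Qed.

Section measurable_rV.
Context {d} {T : sigmaRingType d}.
Variable n : nat.

Let coors : 'I_n -> 'rV[T]_n -> T := fun i x => x ord0 i.

Let rV_set0 : g_sigma_preimage coors set0.
Proof. exact: sigma_algebra0. Qed.

Let rV_setC A : g_sigma_preimage coors A -> g_sigma_preimage coors (~` A).
Proof. exact: sigma_algebraC. Qed.

Let rV_bigcup (F : _^nat) : (forall i, g_sigma_preimage coors (F i)) ->
  g_sigma_preimage coors (\bigcup_i (F i)).
Proof. exact: sigma_algebra_bigcup. Qed.

(* The product sigma-algebra, i.e. for T = R the Borel sets of R^n, as the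
   library does for n.-tuple T. *)
HB.instance Definition _ := @isMeasurable.Build (measure_rV_display d)
  'rV[T]_n (g_sigma_preimage coors) rV_set0 rV_setC rV_bigcup.

End measurable_rV.

Section rV_measurability.
Context {d d1} {T : measurableType d} {T1 : measurableType d1}.

Lemma measurable_rV_coord n (i : 'I_n) :
  measurable_fun [set: 'rV[T]_n] (fun x => x ord0 i).
Proof.
move=> _ Y mY; rewrite setTI; apply: sub_sigma_algebra => /=.
rewrite -bigcup_seq/=; exists i => /=; first by rewrite mem_index_enum.
by exists Y => //; rewrite setTI.
Qed.

Lemma measurable_fun_rVP n (f : T1 -> 'rV[T]_n) :
  (forall i, measurable_fun [set: T1] (fun x => f x ord0 i)) ->
  measurable_fun [set: T1] f.
Proof.
move=> mf.
have H : g_sigma_preimage (fun i x => f x ord0 i) `<=` (@measurable _ T1).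
  apply: smallest_sub; first exact: sigma_algebra_measurable.
  case: n => [|n] in f mf *; first by rewrite big_ord0.
  rewrite -bigcup_mkord_ord; apply: bigcup_sub => i Ii.
  by move=> A [B mB <-]; exact: mf.
move=> _ A mA; apply: H.
have := g_sigma_preimage_comp (fun i (x : 'rV[T]_n) => x ord0 i) f.
by move=> ->; exists A.
Qed.

End rV_measurability.

Section lebesgue_rV.
Context {R : realType}.

Definition cons_rV n (p : measurableTypeR R * 'rV[R]_n) : 'rV[R]_n.+1 :=
  row_mx (p.1%:M : 'rV[R]_1) p.2.

Fixpoint lebesgue_rV n : set 'rV[R]_n -> \bar R :=
  match n with
  | 0 => \d_(0 : 'rV[R]_0)
  | m.+1 => pushforward (@lebesgue_measure R \x lebesgue_rV (n := m))%E
              (@cons_rV m)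
  end.

Lemma measurable_cons_rV n : measurable_fun setT (@cons_rV n).
Proof.
apply: measurable_fun_rVP => i.
case: (@splitP 1 n i) => [j|k] ik.
  rewrite (_ : (fun _ => _) = fst) ; first exact: measurable_fst.
  apply/funext => x; have -> : i = lshift n j by exact/val_inj.
  by rewrite [LHS]row_mxEl mxE (ord1 j) eqxx.
rewrite (_ : (fun _ => _) = (fun y : 'rV[R]_n => y ord0 k) \o snd).
  apply: measurableT_comp; last exact: measurable_snd.
  exact: measurable_rV_coord.
apply/funext => x; have -> : i = rshift 1 k by exact/val_inj.
by rewrite [LHS]row_mxEr.
Qed.

Lemma lebesgue_rV_measure n :
  exists m : {sigma_finite_measure set 'rV[R]_n -> \bar R},
    lebesgue_rV (n := n) = m.
Proof.
elim: n => [|n [m IH]].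
  by exists \d_(0 : 'rV[R]_0).
pose p : {measure set (measurableTypeR R * 'rV[R]_n)%type -> \bar R} :=
  (@lebesgue_measure R \x m)%E.
have sp : sigma_finite setT p.
  have /sigma_finiteP[F [TF ndF Foo]] := sigma_finiteT (@lebesgue_measure R).
  have /sigma_finiteP[G [TG ndG Goo]] := sigma_finiteT m.
  exists (fun n => F n `*` G n).
    rewrite -setXTT TF TG predeqE => -[x y]; split.
      move=> [/= [k _ Fkx] [l _ Gly]]; exists (maxn k l) => //; split.
      - by move: x Fkx; exact/subsetPset/ndF/leq_maxl.
      - by move: y Gly; exact/subsetPset/ndG/leq_maxr.
    by move=> [k _ []/= ? ?]; split; exists k.
  move=> k; have [? ?] := Foo k; have [? ?] := Goo k.
  split; first exact: measurableX.
  rewrite /p/= product_measure1E//.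
  by rewrite lte_mul_pinfty// ge0_fin_numE.
have mc := @measurable_cons_rV n.
have sf : sigma_finite setT (pushforward p (@cons_rV n)).
  have [F FT Foo] := sp.
  pose uc (x : 'rV[R]_n.+1) : measurableTypeR R * 'rV[R]_n :=
    (x ord0 ord0, rsubmx (x : 'rV[R]_(1 + n))).
  have muc : measurable_fun setT uc.
    apply: measurable_fun_pair => /=; first exact: measurable_rV_coord.
    apply: measurable_fun_rVP => i.
    rewrite (_ : (fun _ => _) = fun x : 'rV[R]_n.+1 => x ord0 (rshift 1 i)).
      exact: measurable_rV_coord.
    by apply/funext => x; rewrite mxE.
  have cK : cancel (@cons_rV n) uc.
    move=> [x y]; rewrite /uc /cons_rV/=; congr pair; last exact: row_mxKr.
    have -> : ord0 = @lshift 1 n ord0 :> 'I_n.+1 by exact/val_inj.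
    by rewrite [LHS]row_mxEl mxE eqxx.
  exists (fun k => uc @^-1` F k).
    by rewrite -preimage_bigcup -FT preimage_setT.
  move=> k; have [mFk Fkoo] := Foo k; split.
    by rewrite -[X in measurable X]setTI; exact: muc.
  rewrite /pushforward -comp_preimage (_ : uc \o _ = id)//.
  by apply/funext => z /=; rewrite cK.
pose M0 := measure_function_pushforward__canonical__measure_function_Measure p mc.
pose S0 := Measure_isSigmaFinite.Build _ _ _ M0 sf.
pose M : {sigma_finite_measure set 'rV[R]_n.+1 -> \bar R} := HB.pack (Measure.sort M0) S0.
exists M.
by rewrite /= IH.
Qed.
Let m n := sval (cid (lebesgue_rV_measure n)).
Let mE n : lebesgue_rV (n := n) = m n.
Proof. by rewrite /m; case: cid. Qed.

Let lebesgue_rV0 n : lebesgue_rV (n := n) set0 = 0%E.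
Proof. by rewrite mE measure0. Qed.

Let lebesgue_rV_ge0 n A : (0 <= lebesgue_rV (n := n) A)%E.
Proof. by rewrite mE. Qed.

Let lebesgue_rV_sigma_additive n : semi_sigma_additive (lebesgue_rV (n := n)).
Proof. by rewrite mE; exact: measure_semi_sigma_additive. Qed.

HB.instance Definition _ n := isMeasure.Build _ _ _ (lebesgue_rV (n := n))
  (@lebesgue_rV0 n) (@lebesgue_rV_ge0 n) (@lebesgue_rV_sigma_additive n).

Let lebesgue_rV_sigma_finite n : sigma_finite setT (lebesgue_rV (n := n)).
Proof. by rewrite mE; exact: sigma_finiteT. Qed.

HB.instance Definition _ n := Measure_isSigmaFinite.Build _ _ _
  (lebesgue_rV (n := n)) (@lebesgue_rV_sigma_finite n).

Let box n (A : 'I_n -> set R) : set 'rV[R]_n :=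
  [set x | forall i, A i (x ord0 i)].

Let measurable_box n (A : 'I_n -> set R) :
  (forall i, measurable (A i)) -> measurable (box A).
Proof.
move=> mA.
have -> : box A = \bigcap_(i in setT) ((fun x : 'rV[R]_n => x ord0 i) @^-1` A i).
  by apply/seteqP; split => x /= h i; [move=> _|]; exact: h.
apply: (@fin_bigcap_measurable _ 'rV[R]_n 'I_n setT).
  exact: finite_finset.
by move=> i _; rewrite -[X in measurable X]setTI; exact: measurable_rV_coord.
Qed.

Lemma lebesgue_rV_box n (A : 'I_n -> set R) :
  (forall i, measurable (A i)) ->
  lebesgue_rV (n := n) [set x | forall i, A i (x ord0 i)] =
  (\prod_i @lebesgue_measure R (A i))%E.
Proof.
elim: n A => [|n IH] A mA.
  by rewrite big_ord0 /= diracE mem_set// => -[].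
rewrite big_ord_recl /= -IH// /pushforward.
have mB := @measurable_box n (fun i => A (lift ord0 i)) (fun i => mA _).
have mA0 : @measurable _ (measurableTypeR R) (A ord0) by exact: mA.
rewrite -[RHS](product_measure1E (@lebesgue_measure R)
  (lebesgue_rV (n := n)) mA0 mB).
have c0 x y : cons_rV (n := n) (x, y) ord0 ord0 = x.
  rewrite [X in cons_rV _ _ X](_ : _ = @lshift 1 n ord0); last exact/val_inj.
  by rewrite [LHS]row_mxEl mxE eqxx.
have cS x y i : cons_rV (n := n) (x, y) ord0 (lift ord0 i) = y ord0 i.
  rewrite [X in cons_rV _ _ X](_ : _ = @rshift 1 n i); last exact/val_inj.
  by rewrite [LHS]row_mxEr.
congr product_measure1; apply/seteqP; split=> -[x y] /=.
  move=> h; split=> [|i] /=; first by have := h ord0; rewrite c0.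
  by have := h (lift ord0 i); rewrite cS.
move=> [/= hx hy] i; have [k ->|->] := unliftP ord0 i; last by rewrite c0.
by rewrite cS; exact: hy.
Qed.

End lebesgue_rV.
Arguments lebesgue_rV {R} n A.

Section integral_ae_measurable.
Local Open Scope ereal_scope.
Context d (T : measurableType d) (R : realType).
Variable mu : {measure set T -> \bar R}.
Implicit Types (D : set T) (f g : T -> \bar R).

Import HBNNSimple.

Let ge0_ae_integral f g : (forall x, 0 <= f x) -> (forall x, 0 <= g x) ->
  measurable_fun setT g -> {ae mu, forall x, f x = g x} ->
  \int[mu]_x f x = \int[mu]_x g x.
Proof.
move=> f0 g0 mg [N [mN N0 fgN]].
have fg x : ~ N x -> f x = g x by move=> Nx; apply: contrapT => /fgN.
have mCN := measurableC mN.
have mr (h : T -> \bar R) : measurable_fun setT h ->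
    measurable_fun setT (h \_ (~` N)).
  by move=> mh; apply/(measurable_restrictT _ _).1 => //; exact: measurable_funTS.
have intCN (h : T -> \bar R) : measurable_fun setT h ->
    \int[mu]_x h x = \int[mu]_x (h \_ (~` N)) x.
  move=> mh; apply: ae_eq_integral => //; first exact: mr.
  exists N; split => // x /=; apply: contra_notP => Nx _.
  by rewrite patchE mem_set.
rewrite ge0_integralTE//; apply/eqP; rewrite eq_le; apply/andP; split.
  apply: ge_ereal_sup => _ [h /= hf <-].
  have mh : measurable_fun setT (EFin \o h) by exact/measurable_EFinP.
  rewrite -integralT_nnsfun intCN// [leRHS]intCN//.
  apply: ge0_le_integral => //.
  - by move=> x _; rewrite patchE; case: ifP => // _; rewrite /= lee_fin.
  - exact: mr.
  - exact: mr.
  move=> x _; rewrite !patchE; case: ifP => // xN; rewrite -fg//.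
  by move: xN; rewrite inE.
rewrite intCN// ge0_integralTE; last by move=> x; rewrite patchE; case: ifP.
apply: ereal_sup_le => _ [h /= hg <-]; exists h => //= x.
apply: (le_trans (hg x)); rewrite patchE; case: ifP => // xN.
by rewrite fg//; move: xN; rewrite inE.
Qed.

Lemma integral_ae_measurable D f g : measurable D -> measurable_fun D g ->
  {ae mu, forall x, D x -> f x = g x} ->
  \int[mu]_(x in D) f x = \int[mu]_(x in D) g x.
Proof.
move=> mD mg fg; rewrite integral_mkcond [RHS]integral_mkcond.
have {}mg : measurable_fun setT (g \_ D) by exact/(measurable_restrictT _ _).1.
have {}fg : {ae mu, forall x, (f \_ D) x = (g \_ D) x}.
  apply: filterS fg => x fg; rewrite !patchE.
  by case: ifP => // xD; apply: fg; move: xD; rewrite inE.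
rewrite integralE [RHS]integralE; congr (_ - _); apply: ge0_ae_integral => //.
- exact: measurable_funepos.
- by apply: filterS fg => x fg; rewrite !funeposE fg.
- exact: measurable_funeneg.
- by apply: filterS fg => x fg; rewrite !funenegE fg.
Qed.

End integral_ae_measurable.

Section fractional_sobolev.
Context {R : realType}.
Variable n : nat.
Local Notation mu := (@lebesgue_rV R n).
Implicit Types (s : R) (x y : 'rV[R]_n) (a f u v : 'rV[R]_n -> R).

(* The library's norm on 'rV[R]_n is the sup norm. *)
Definition enorm x : R := Num.sqrt (\sum_i x ord0 i ^+ 2).

Definition eball x (r : R) : set 'rV[R]_n := [set y | enorm (y - x) < r].

(* Measurability for the completed (Lebesgue) sigma-algebra: agreement almost
   everywhere with a Borel function. The library's integral only depends on the
   almost everywhere class of such a function: see integral_ae_measurable. *)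
Definition lebesgue_measurable f : Prop :=
  exists2 g : 'rV[R]_n -> R,
    measurable_fun setT g & {ae mu, forall x, f x = g x}.

Definition L1loc f : Prop :=
  lebesgue_measurable f /\
  forall K : set 'rV[R]_n, compact K -> (\int[mu]_(x in K) `|f x|%:E < +oo)%E.

Definition L2 f : Prop :=
  lebesgue_measurable f /\ (\int[mu]_x (f x ^+ 2)%:E < +oo)%E.

(* On the diagonal, which is mu \x mu-null for 0 < n, the integrand is 0 / 0 = 0. *)
Definition bilinear_form s u v : \bar R :=
  (\int[mu \x mu]_p ((u p.1 - u p.2) * (v p.1 - v p.2) /
                     enorm (p.1 - p.2) `^ (n%:R + 2 * s))%:E)%E.

Definition Hs s u : Prop :=
  L2 u /\
  (\int[mu \x mu]_p ((u p.1 - u p.2) ^+ 2 /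
                     enorm (p.1 - p.2) `^ (n%:R + 2 * s))%:E < +oo)%E.

(* The positive and negative parts do not both have infinite integral. *)
Definition integral_well_defined (f : 'rV[R]_n -> \bar R) : Prop :=
  ((\int[mu]_x f^\+ x) +? (- \int[mu]_x f^\- x))%E.

End fractional_sobolev.

(* Main.v *)
Require Import Defs.
From HB Require Import structures.
From mathcomp Require Import all_boot all_order all_algebra.
From mathcomp Require Import all_classical all_reals all_analysis.
From mathcomp Require Import measurable_realfun.
From mathcomp Require Import ring lra.

(** The function is tested with [v = phi^2 / (d + u)], where [phi] is the Lipschitz cutoff
equal to 1 on the ball of radius [r] and to 0 outside the ball of radius [2 * r]. Write
[U] and [V] for the values of [d + u] at [x] and [y], and [al] and [be] for those of
[phi]. The integrand of the form carries the factor
[(U - V) (al^2 / U - be^2 / V) = al^2 + be^2 - al^2 V / U - be^2 U / V],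
which is always at most [(al - be)^2] ([cutoff_quotient_le]). When [al = be = 1] it equals
[2 - t - t^-1] with [t = U / V], hence is at most [- (ln t)^2], because
[t + t^-1 - 2 = 4 (sinh (ln t / 2))^2] ([sqr_ln_le], [reciprocal_log_le]). Since moreover
[a u v <= a phi^2], the supersolution inequality yields that the logarithmic energy on
the small ball is at most the energy of [phi] plus the integral of [a] over the large
ball ([log_energy_le]).

The constant comes from the energy of [phi] ([cutoff_energy]). The pairs with nonzero
increment and at distance less than [rho] have measure at most a constant times
[r^n rho^n], by slicing and by the inclusion of balls in cubes ([lebesgue_near_pairs]).
Summing over dyadic shells of distances gives geometric series of ratios
[2^(2 s - 2)] below [r] and [2^(- 2 s)] above, and the total scales like the power
[n - 2 s] of [r].

Nonnegativity of [u] is the weak maximum principle ([supersolution_ae_ge0]): tested with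
the negative part of [u], the inequality forces that part to have zero energy, hence to be
almost everywhere constant, and a square integrable constant on a space of infinite
measure is zero.

The functions [a] and [u] are Borel only up to null sets, so they are first replaced by
nonnegative Borel representatives, which changes none of the integrals
([supersolution_borel], [Hs_ae]). *)

Import Order.TTheory GRing.Theory Num.Theory.
Import numFieldNormedType.Exports.

Local Open Scope classical_set_scope.
Local Open Scope ring_scope.

Set Implicit Arguments.
Unset Strict Implicit.

(** * Scalar inequalities *)

(** Twice the inequality [sinh x >= x]: the difference of the two sides vanishes at 0
and has derivative [expR x + expR (- x) - 2 >= 0]. *)
Lemma sinh_ge (R : realType) (x : R) : 0 <= x -> 2 * x <= expR x - expR (- x).
Proof.
move=> x0.
pose f (y : R) := expR y - expR (- y) - 2 * y.
have df (y : R) : is_derive y 1 f (expR y + expR (- y) - 2).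
  rewrite /f; apply: is_derive_eq.
  rewrite /= /GRing.scale /=; ring.
suff : f 0 <= f x by rewrite /f oppr0; lra.
apply: (@ger0_derive1_ndecry R f 0) => //.
- move=> y _; rewrite derive1E (@derive_val _ _ _ _ _ _ _ (df y)).
  have e0 := expR_gt0 y; rewrite expRN.
  have := sqr_ge0 (expR y - 1); rewrite sqrrB expr1n mulr1 => h.
  suff : 0 <= (expR y + (expR y)^-1 - 2) * expR y by rewrite pmulr_lge0.
  rewrite mulrBl mulrDl mulVf ?gt_eqF//; move: h; rewrite expr2; lra.
- apply: continuous_subspaceT => y.
  by apply: differentiable_continuous; apply/derivable1_diffP; have [] := df y.
Qed.

(** With [w = ln t / 2] the right-hand side is [(expR w - expR (- w)) ^+ 2], that is
[4 (sinh w)^2], which [sinh_ge] compares with [(2 w)^2]. *)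
Lemma sqr_ln_le (R : realType) (t : R) : 0 < t -> ln t ^+ 2 <= t + t^-1 - 2.
Proof.
move=> t0.
have -> : t + t^-1 - 2 = (expR (ln t / 2) - expR (- (ln t / 2))) ^+ 2.
  have et : t = expR (ln t / 2) ^+ 2.
    by rewrite -expRM_natr (_ : _ * 2%:R = ln t) ?lnK//; field.
  rewrite [in LHS]et expRN; field; exact/lt0r_neq0/expR_gt0.
set w := ln t / 2.
have -> : ln t = 2 * w by rewrite /w; field.
clearbody w.
have [w0|w0] := leP 0 w.
  by rewrite !expr2 ler_pM ?mulr_ge0 ?sinh_ge.
have nw : 0 <= - w by lra.
rewrite -sqrrN -[leRHS]sqrrN opprB -mulrN -{3}(opprK w).
by rewrite !expr2 ler_pM ?mulr_ge0 ?sinh_ge.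
Qed.

(** Expanding the left-hand side gives [al^2 + be^2 - al^2 V / U - be^2 U / V], and the
last two terms are at most [- 2 al be] by the arithmetic-geometric mean inequality. *)
Lemma cutoff_quotient_le (R : realFieldType) (U V al be : R) : 0 < U -> 0 < V ->
  (U - V) * (al ^+ 2 / U - be ^+ 2 / V) <= (al - be) ^+ 2.
Proof.
move=> U0 V0; rewrite -subr_ge0.
have -> : (al - be) ^+ 2 - (U - V) * (al ^+ 2 / U - be ^+ 2 / V) =
   (al * V - be * U) ^+ 2 / (U * V).
  by field; rewrite !gt_eqF.
by rewrite divr_ge0 ?sqr_ge0// mulr_ge0// ltW.
Qed.

(** Where the cutoff is 1 the bound of [cutoff_quotient_le] improves to minus a squared
logarithm. The coefficient of the logarithm is exactly 1, hence so is the coefficient of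
the integral of the potential in the final estimate. *)
Lemma reciprocal_log_le (R : realType) (U V : R) : 0 < U -> 0 < V ->
  (U - V) * (U^-1 - V^-1) <= - ln (U / V) ^+ 2.
Proof.
move=> U0 V0.
have := sqr_ln_le (divr_gt0 U0 V0).
have -> : (U - V) * (U^-1 - V^-1) = - (U / V + (U / V)^-1 - 2).
  by field; rewrite !gt_eqF.
by rewrite lerN2.
Qed.

(** This is why the test function [phi^2 / (d + u)] has finite energy: its increments are
controlled by those of [phi] and of [u]. *)
Lemma test_increment_le (R : realFieldType) (d al be u w : R) : 0 < d ->
  0 <= al <= 1 -> 0 <= be <= 1 -> 0 <= u -> 0 <= w ->
  (al ^+ 2 / (d + u) - be ^+ 2 / (d + w)) ^+ 2 <=
  8 / d ^+ 2 * (al - be) ^+ 2 + 2 / d ^+ 4 * (u - w) ^+ 2.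
Proof.
move=> d0 /andP[a0 a1] /andP[b0 b1] u0 w0.
have U0 : 0 < d + u by lra.
have W0 : 0 < d + w by lra.
pose p := (al + be) / (d + u) * (al - be).
pose q := be ^+ 2 / ((d + u) * (d + w)) * (w - u).
have -> : al ^+ 2 / (d + u) - be ^+ 2 / (d + w) = p + q.
  by rewrite /p /q; field; rewrite !gt_eqF.
have pq : (p + q) ^+ 2 <= 2 * p ^+ 2 + 2 * q ^+ 2.
  by rewrite -subr_ge0 (_ : _ - _ = (p - q) ^+ 2) ?sqr_ge0//; ring.
apply: (le_trans pq).
have iU0 : 0 <= (d + u)^-1 by rewrite invr_ge0 ltW.
have iW0 : 0 <= (d + w)^-1 by rewrite invr_ge0 ltW.
have iU : (d + u)^-1 <= d^-1 by rewrite lef_pV2 ?posrE//; lra.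
have iW : (d + w)^-1 <= d^-1 by rewrite lef_pV2 ?posrE//; lra.
apply: lerD.
  rewrite /p exprMn mulrA ler_wpM2r ?sqr_ge0//.
  have -> : 8 / d ^+ 2 = 2 * (2 * d^-1) ^+ 2 by field; rewrite gt_eqF.
  have h : (al + be) / (d + u) <= 2 * d^-1 by apply: ler_pM => //; lra.
  have h0 : 0 <= (al + be) / (d + u) by apply: mulr_ge0 => //; lra.
  by rewrite ler_pM2l// !expr2 ler_pM.
rewrite /q exprMn mulrA (_ : (w - u) ^+ 2 = (u - w) ^+ 2); last by ring.
rewrite ler_wpM2r ?sqr_ge0//.
have -> : 2 / d ^+ 4 = 2 * (1 * (d^-1 * d^-1)) ^+ 2 by field; rewrite gt_eqF.
have h : be ^+ 2 / ((d + u) * (d + w)) <= 1 * (d^-1 * d^-1).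
  rewrite invfM; apply: ler_pM; rewrite ?sqr_ge0 ?mulr_ge0//.
    by rewrite exprn_ile1.
  exact: ler_pM.
have h0 : 0 <= be ^+ 2 / ((d + u) * (d + w)).
  by rewrite invfM; apply: mulr_ge0; rewrite ?sqr_ge0 ?mulr_ge0.
by rewrite ler_pM2l// [leLHS]expr2 [leRHS]expr2 ler_pM.
Qed.

(** * The Euclidean norm and its balls *)

Section enorm.
Variables (R : realType) (n : nat).
Implicit Types x y z : 'rV[R]_n.

Lemma enorm_ge0 x : 0 <= enorm x.
Proof. exact: sqrtr_ge0. Qed.

Lemma sqr_enorm x : enorm x ^+ 2 = \sum_i x ord0 i ^+ 2.
Proof. by rewrite sqr_sqrtr// sumr_ge0// => i _; exact: sqr_ge0. Qed.

Lemma enorm_coord x i : `|x ord0 i| <= enorm x.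
Proof.
rewrite -sqrtr_sqr ler_wsqrtr// (bigD1 i)//= lerDl sumr_ge0// => j _.
exact: sqr_ge0.
Qed.

Lemma enorm_eq0 x : enorm x = 0 -> x = 0.
Proof.
move=> x0; apply/rowP => i; rewrite mxE; apply/eqP.
by rewrite -normr_le0 -x0 enorm_coord.
Qed.

Lemma enormN x : enorm (- x) = enorm x.
Proof. by rewrite /enorm; under eq_bigr do rewrite mxE sqrrN. Qed.

Lemma enormBC x y : enorm (x - y) = enorm (y - x).
Proof. by rewrite -enormN opprB. Qed.

Lemma cauchy_schwarz x y : \sum_i x ord0 i * y ord0 i <= enorm x * enorm y.
Proof.
have [x0|/eqP xN0] := eqVneq (enorm x) 0.
  by rewrite x0 mul0r big1// => i _; rewrite (enorm_eq0 x0) mxE mul0r.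
have [y0|/eqP yN0] := eqVneq (enorm y) 0.
  by rewrite y0 mulr0 big1// => i _; rewrite (enorm_eq0 y0) mxE mulr0.
have X0 : 0 < enorm x by rewrite lt_def enorm_ge0 andbT; exact/eqP.
have Y0 : 0 < enorm y by rewrite lt_def enorm_ge0 andbT; exact/eqP.
(* Young's inequality, weighted so that the sum over i is exactly the product of norms. *)
have key i : x ord0 i * y ord0 i <= 2^-1 * (enorm y / enorm x) * x ord0 i ^+ 2
    + 2^-1 * (enorm x / enorm y) * y ord0 i ^+ 2.
  rewrite -subr_ge0 (_ : _ - _ = 2^-1 *
    (enorm y * x ord0 i - enorm x * y ord0 i) ^+ 2 / (enorm x * enorm y)).
    apply: divr_ge0; last exact: ltW (mulr_gt0 X0 Y0).
    by apply: mulr_ge0; [rewrite invr_ge0|exact: sqr_ge0].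
  by field; rewrite !gt_eqF.
apply: (le_trans (ler_sum _ (fun i _ => key i))).
rewrite big_split/= -!mulr_sumr -!sqr_enorm le_eqVlt; apply/orP; left.
by apply/eqP; field; rewrite !gt_eqF.
Qed.

Lemma enormD x y : enorm (x + y) <= enorm x + enorm y.
Proof.
have s0 : 0 <= enorm x + enorm y by rewrite addr_ge0 ?enorm_ge0.
rewrite -(ger0_norm s0) -sqrtr_sqr ler_wsqrtr// sqrrD !sqr_enorm.
under eq_bigr do rewrite mxE sqrrD.
by rewrite !big_split/= lerD2r lerD2l mulr2n lerD ?cauchy_schwarz.
Qed.

Lemma ler_dist_enorm x y : `|enorm x - enorm y| <= enorm (x - y).
Proof.
rewrite ler_norml; apply/andP; split.
  by have := enormD (y - x) x; rewrite subrK enormBC; lra.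
by have := enormD (x - y) y; rewrite subrK; lra.
Qed.

Lemma measurable_enorm d (T : measurableType d) (f : T -> 'rV[R]_n) :
  (forall i, measurable_fun setT (fun t => f t ord0 i)) ->
  measurable_fun setT (fun t => enorm (f t)).
Proof.
move=> mf; apply: (measurableT_comp (f := @Num.sqrt R)).
  by apply: continuous_measurable_fun; exact: sqrt_continuous.
apply: measurable_sum => i.
exact: measurable_funX (mf i).
Qed.

Lemma measurable_enormB1 x : measurable_fun setT (fun y => enorm (y - x)).
Proof.
apply: measurable_enorm => i; under eq_fun do rewrite !mxE.
by apply: measurable_funD => //; exact: measurable_rV_coord.
Qed.

Lemma measurable_enormB2 :
  measurable_fun setT (fun p : 'rV[R]_n * 'rV[R]_n => enorm (p.1 - p.2)).
Proof.
apply: measurable_enorm => i; under eq_fun do rewrite !mxE.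
apply: measurable_funB.
  exact: (measurableT_comp (measurable_rV_coord i) measurable_fst).
exact: (measurableT_comp (measurable_rV_coord i) measurable_snd).
Qed.

Lemma measurable_eball x (r : R) : measurable (eball x r).
Proof.
rewrite (_ : eball x r = (fun y => enorm (y - x)) @^-1` `]-oo, r[%classic).
  by rewrite -[X in measurable X]setTI; exact: measurable_enormB1.
by apply/seteqP; split => y; rewrite /eball/= in_itv.
Qed.

(** The ball is contained in the cube of side [2 * r] with the same centre. *)
Lemma lebesgue_eball x (r : R) : 0 <= r ->
  (lebesgue_rV n (eball x r) <= ((2 * r) ^+ n)%:E)%E.
Proof.
move=> r0; pose A i : set R := `[x ord0 i - r, x ord0 i + r]%classic.
have mA i : measurable (A i) by exact: measurable_itv.
apply: (@le_trans _ _ (lebesgue_rV n [set y | forall i, A i (y ord0 i)])).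
  apply: le_measure; rewrite ?inE; first exact: measurable_eball.
    rewrite [X in measurable X](_ : _ =
        \bigcap_(i in setT) ((fun y : 'rV[R]_n => y ord0 i) @^-1` A i)).
      apply: fin_bigcap_measurable; first exact: finite_finset.
      by move=> i _; rewrite -[X in measurable X]setTI; exact: measurable_rV_coord.
    by apply/seteqP; split => y /= h i; [move=> _|]; exact: h.
  move=> y; rewrite /eball/= => yr i; rewrite /A/= in_itv/=.
  have := le_lt_trans (enorm_coord (y - x) i) yr; rewrite !mxE ltr_norml => /andP[].
  by move=> h1 h2; apply/andP; split; lra.
rewrite lebesgue_rV_box// (eq_bigr (fun _ => (2 * r)%:E)); last first.
  move=> i _; rewrite lebesgue_measure_itv/= lte_fin.
  have [rp|] := ltP; first by rewrite -EFinB; congr (_%:E); lra.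
  by move=> h; have -> : r = 0; [lra|rewrite mulr0].
by rewrite -(big_morph EFin (@EFinM R) (erefl _)) prodr_const card_ord.
Qed.

Lemma lebesgue_rVT : (0 < n)%N -> lebesgue_rV n [set: 'rV[R]_n] = +oo%E.
Proof.
move=> n0; have -> : [set: 'rV[R]_n] = [set x | forall i, setT (x ord0 i)].
  by apply/seteqP; split.
rewrite (lebesgue_rV_box (A := fun=> setT))// (eq_bigr (fun=> +oo%E)).
  case: n n0 => // m _; rewrite big_ord_recl; elim/big_ind : _ => //.
  - by rewrite mule1.
  - by move=> x y; rewrite muleA => ->.
by move=> i _; rewrite -set_itvNyy lebesgue_measure_itv.
Qed.

End enorm.

(** * The fractional energy of a cutoff *)

Lemma powR_exprn (R : realType) (a x : R) (j : nat) : 0 <= a ->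
  (a ^+ j) `^ x = (a `^ x) ^+ j.
Proof.
move=> a0; elim: j => [|j IH]; first by rewrite !expr0 powR1.
by rewrite !exprS powRM ?exprn_ge0// IH.
Qed.

(** Every positive distance lies in a dyadic shell; the shells inside and outside radius [r] are
listed separately because the increments of a cutoff are estimated differently there. *)
Lemma dyadic_shell (R : realType) (r t : R) : 0 < r -> 0 < t ->
  exists j : nat, (r / 2 ^+ j / 2 <= t < r / 2 ^+ j) \/
                  (r * 2 ^+ j.+1 / 2 <= t < r * 2 ^+ j.+1).
Proof.
move=> r0 t0.
have big (x y : R) : 0 < x -> exists m : nat, y < x * 2 ^+ m.
  move=> x0; exists (Num.truncn (y / x)).+1.
  rewrite mulrC -ltr_pdivrMr// (lt_le_trans (truncnS_gt _))//.
  by rewrite -natrX ler_nat ltnW// ltn_expl.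
have [tr|rt] := ltP t r.
  have Hm : exists m : nat, r <= t * 2 ^+ m.
    by have [m /ltW rm] := big t r t0; exists m.
  case: (ex_minnP Hm) => -[|j] rj jmin; first by move: rj; rewrite expr0; lra.
  exists j; left; rewrite ltr_pdivlMr ?exprn_gt0// ltNge.
  apply/andP; split; last by apply/negP => /jmin; rewrite ltnn.
  by rewrite -mulrA -invfM ler_pdivrMr ?mulr_gt0 ?exprn_gt0// -exprSr.
case: (ex_minnP (big r t r0)) => -[|j] tj jmin.
  by move: tj; rewrite expr0; lra.
exists j; right; rewrite tj andbT exprSr mulrA mulfK// leNgt.
by apply/negP => /jmin; rewrite ltnn.
Qed.

(** A function that is dominated at each point by some term of a sequence is dominated by
the sum of the sequence. This turns a bound on each dyadic shell into a bound on the
whole space without any disjointness of the shells. *)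
Lemma integral_le_geometric d (T : measurableType d) (R : realType)
    (mu : {measure set T -> \bar R}) (f : T -> \bar R) (F : nat -> T -> R)
    (M q : R) :
  measurable_fun setT f -> (forall x, 0 <= f x)%E ->
  (forall j, measurable_fun setT (F j)) -> (forall j x, 0 <= F j x) ->
  (forall x, exists j, f x <= (F j x)%:E)%E ->
  (forall j, \int[mu]_x (F j x)%:E <= (M * q ^+ j)%:E)%E ->
  0 <= M -> 0 < q < 1 ->
  (\int[mu]_x f x <= (M / (1 - q))%:E)%E.
Proof.
move=> mf f0 mF F0 fF iF M0 /andP[q0 q1].
have mEF j : measurable_fun setT (fun x => (F j x)%:E) by exact/measurable_EFinP.
have F0' j x : (0 <= (F j x)%:E)%E by rewrite lee_fin.
apply: (@le_trans _ _ (\int[mu]_x (\sum_(0 <= j <oo) (F j x)%:E))%E).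
  apply: ge0_le_integral => //; first by apply: ge0_emeasurable_sum.
  move=> x _; have [j fj] := fF x; apply: (le_trans fj).
  have := @nneseries_lim_ge R (fun j => (F j x)%:E) xpredT 0 j.+1 (fun _ _ _ => F0' _ _).
  apply: le_trans; rewrite big_nat_recr//= leeDr// sume_ge0//.
rewrite integral_nneseries//.
apply: (@le_trans _ _ (\sum_(0 <= j <oo) (M * q ^+ j)%:E)%E).
  by apply: lee_nneseries => // j _ _; exact: integral_ge0.
apply: lime_le.
  apply: is_cvg_nneseries => j _ _; rewrite lee_fin mulr_ge0// exprn_ge0//.
  exact: ltW.
apply: nearW => m; rewrite sumEFin lee_fin.
have := @geometric_le_lim R m M q M0 q0; rewrite gtr0_norm// => /(_ q1).
by rewrite /series/=.
Qed.

Section near_pairs.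
Variables (R : realType) (n : nat).
Local Notation mu := (@lebesgue_rV R n).
Local Notation E := 'rV[R]_n.

(** The pairs at distance less than [rho] on which a cutoff supported in the ball can have
a nonzero increment. *)
Definition near_pairs (x0 : E) (r rho : R) : set (E * E) :=
  [set p | enorm (p.1 - p.2) < rho /\ (eball x0 r p.1 \/ eball x0 r p.2)].

Lemma measurable_band (rho : R) :
  measurable [set p : E * E | enorm (p.1 - p.2) < rho].
Proof.
rewrite (_ : mkset _ = (fun p : E * E => enorm (p.1 - p.2)) @^-1` `]-oo, rho[%classic).
  by rewrite -[X in measurable X]setTI; exact: measurable_enormB2.
by apply/seteqP; split => p /=; rewrite in_itv.
Qed.

Lemma near_pairsE x0 r rho : near_pairs x0 r rho =
  ([set p | enorm (p.1 - p.2) < rho] `&` (eball x0 r `*` setT)) `|`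
  ([set p | enorm (p.1 - p.2) < rho] `&` (setT `*` eball x0 r)).
Proof.
apply/seteqP; split=> [p [pr [h|h]]|p [[/= h [h1 h2]]|[/= h [h1 h2]]]].
- by left; split.
- by right; split.
- by split => //; left.
- by split => //; right.
Qed.

Lemma measurable_near_pairs x0 r rho : measurable (near_pairs x0 r rho).
Proof.
have mB := measurable_eball x0 r.
rewrite near_pairsE; apply: measurableU; apply: measurableI;
  by [exact: measurable_band|exact: measurableX].
Qed.

(** Used with [h x] the measure of the section at [x] of a set of pairs, which is contained
in a ball of radius [rho], and is empty unless [x] is in the ball of radius [r]. *)
Lemma section_integral_le x0 (r rho : R) (h : E -> \bar R) : 0 <= r -> 0 <= rho ->
  measurable_fun setT h -> (forall x, 0 <= h x)%E ->
  (forall x, h x <= ((2 * rho) ^+ n * \1_(eball x0 r) x)%:E)%E ->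
  (\int[mu]_x h x <= ((2 * r) ^+ n * (2 * rho) ^+ n)%:E)%E.
Proof.
move=> r0 rho0 mh h0 hle.
have mB := measurable_eball x0 r.
have c0 : 0 <= (2 * rho) ^+ n by rewrite exprn_ge0// mulr_ge0.
apply: (@le_trans _ _ (\int[mu]_x ((2 * rho) ^+ n * \1_(eball x0 r) x)%:E)%E).
  apply: ge0_le_integral => //.
  by apply/measurable_EFinP; apply: measurable_funM => //; exact: measurable_indic.
under eq_integral do rewrite EFinM.
rewrite ge0_integralZl//; last by apply/measurable_EFinP; exact: measurable_indic.
rewrite integral_indic// setIT (mulrC ((2 * r) ^+ n)) EFinM.
by apply: lee_wpmul2l; [rewrite lee_fin|exact: lebesgue_eball].
Qed.

Lemma lebesgue_near_pairs x0 (r rho : R) : 0 <= r -> 0 <= rho ->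
  ((mu \x mu) (near_pairs x0 r rho) <=
   (2 * ((2 * r) ^+ n * (2 * rho) ^+ n))%:E)%E.
Proof.
move=> r0 rho0; rewrite near_pairsE.
have mB := measurable_eball x0 r.
have mD := measurable_band rho.
set A := _ `&` _; set A' := _ `&` (setT `*` _).
have mA : measurable A by apply: measurableI => //; exact: measurableX.
have mA' : measurable A' by apply: measurableI => //; exact: measurableX.
apply: (le_trans (measureU2 _ _ _)) => //.
rewrite mulr_natl mulr2n EFinD; apply: leeD.
  rewrite /product_measure1; apply: (section_integral_le (x0 := x0) r0 rho0).
  - exact: measurable_fun_xsection.
  - by move=> x.
  move=> x /=; rewrite indicE; case: (boolP (x \in eball x0 r)) => xB.
    rewrite /= mulr1; apply: le_trans (lebesgue_eball x rho0).
    apply: le_measure; rewrite ?inE; first exact: measurable_xsection.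
      exact: measurable_eball.
    by move=> y; rewrite /xsection/= inE /A/= => -[/= h _]; rewrite /eball/= enormBC.
  rewrite /= mulr0 (_ : xsection A x = set0) ?measure0//.
  apply/seteqP; split=> y //; rewrite /xsection/= inE /A/= => -[_ [/= xB' _]].
  by move: xB; rewrite notin_setE.
(* The second half of the set is sliced along the second variable instead. *)
have mE : (mu \x mu)%E A' = (mu \x^ mu)%E A'.
  apply: product_measure_unique => // B1 B2 mB1 mB2; exact: product_measure2E.
apply: (@le_trans _ _ ((mu \x^ mu)%E A')); first by rewrite -mE.
clear mE.
rewrite /product_measure2; apply: (section_integral_le (x0 := x0) r0 rho0).
- exact: measurable_fun_ysection.
- by move=> x.
move=> x /=; rewrite indicE; case: (boolP (x \in eball x0 r)) => xB.
  rewrite /= mulr1; apply: le_trans (lebesgue_eball x rho0).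
  apply: le_measure; rewrite ?inE; first exact: measurable_ysection.
    exact: measurable_eball.
  by move=> y; rewrite /ysection/= inE /A'/= => -[/= h _].
rewrite /= mulr0 (_ : ysection A' x = set0) ?measure0//.
apply/seteqP; split=> y //; rewrite /ysection/= inE /A'/= => -[_ [/= _ xB']].
by move: xB; rewrite notin_setE.
Qed.

End near_pairs.

Lemma powR2_inv (R : realType) (x : R) : (2^-1 : R) `^ x = (2 `^ x)^-1.
Proof. by rewrite -powRN -powR_inv1// -powRrM mulN1r. Qed.

(** The lower bound makes the sum over the outer shells converge, the upper bound the sum
over the inner shells. *)
Lemma powR2_lt4 (R : realType) (s : R) : 0 < s < 1 -> 1 < (2 : R) `^ (2 * s) < 4.
Proof.
have gt1 (x : R) : 0 < x -> 1 < (2 : R) `^ x.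
  move=> x0; have := @gt0_ltr_powR R x x0 1 2.
  by rewrite powR1; apply; rewrite ?nnegrE// ltr1n.
move=> /andP[s0 s1]; rewrite gt1 ?mulr_gt0//=.
have : 1 < (2 : R) `^ (2 * (1 - s)) by apply: gt1; rewrite mulr_gt0// subr_gt0.
have : (2 : R) `^ (2 * (1 - s)) * (2 : R) `^ (2 * s) = 4.
  rewrite -powRD ?pnatr_eq0 ?implybT//.
  by rewrite (_ : _ + _ = 2%:R) ?powR_mulrn//; ring.
have := powR_gt0 (2 * s) (ltr0Sn R 1).
set P := 2 `^ (2 * s); set Q := 2 `^ _ => P0 QP Q1.
by rewrite -QP ltr_pMl.
Qed.

Lemma integral_scaled_indic d (T : measurableType d) (R : realType)
    (mu : {measure set T -> \bar R}) (A : set T) (c : R) :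
  0 <= c -> measurable A ->
  (\int[mu]_x (c * \1_A x)%:E = c%:E * mu A)%E.
Proof.
move=> c0 mA; under eq_integral do rewrite EFinM.
rewrite ge0_integralZl//; last by apply/measurable_EFinP; exact: measurable_indic.
by rewrite integral_indic// setIT.
Qed.

Section cutoff_energy_bound.
Variables (R : realType) (n : nat).
Local Notation mu := (@lebesgue_rV R n).
Local Notation E := 'rV[R]_n.

Lemma measurable_kernel (s : R) : measurable_fun setT
  (fun p : E * E => (enorm (p.1 - p.2) `^ (n%:R + 2 * s))^-1).
Proof.
under eq_fun do rewrite -powRN.
exact: (measurableT_comp (measurable_powR _) (@measurable_enormB2 R n)).
Qed.

Lemma measurable_increment (u : E -> R) : measurable_fun setT u ->
  measurable_fun setT (fun p : E * E => u p.1 - u p.2).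
Proof.
move=> mes_u; apply: measurable_funB.
  exact: (measurableT_comp mes_u measurable_fst).
exact: (measurableT_comp mes_u measurable_snd).
Qed.

(** The supremum of the kernel on the shell of outer radius [rho] times the bound of
[lebesgue_near_pairs] for a ball of radius [2 * r]: the powers of [rho] with exponent [n]
cancel, and only the fractional power is left to be summed. *)
Lemma shell_bound (s r rho : R) : 0 < s -> 0 < r -> 0 < rho ->
  ((rho / 2) `^ (n%:R + 2 * s))^-1 * (2 * ((2 * (2 * r)) ^+ n * (2 * rho) ^+ n))
  = 2 * 16 ^+ n * 2 `^ (2 * s) * r ^+ n * (rho `^ (2 * s))^-1.
Proof.
move=> s0 r0 rho0.
have ns0 : 0 < n%:R + 2 * s by rewrite ltr_wpDl// mulr_gt0.
rewrite powRM ?invr_ge0 ?ltW// powRD ?gt_eqF ?implybT//.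
rewrite powRD ?invr_eq0 ?pnatr_eq0 ?implybT// !powR_mulrn ?invr_ge0 ?ltW//.
rewrite powR2_inv.
rewrite !exprMn exprVn (_ : 16 = 2 * 2 * 2 * 2 :> R); last by ring.
have P0 := powR_gt0 (2 * s) (ltr0Sn R 1).
have rho0' := powR_gt0 (2 * s) rho0.
rewrite !exprMn; field.
by rewrite !gt_eqF ?exprn_gt0.
Qed.

(** On a shell of outer radius [rho <= r] the squared increment is at most [(rho / r)^2],
and on the others it is at most 1. By [shell_bound] the shells then contribute, up to a
constant, [r `^ (n%:R - 2 * s)] times the terms of a geometric series of ratio [P / 4]
inside radius [r] and [P^-1] outside, where [P] is the power [2 * s] of 2. *)
Lemma cutoff_energy (s : R) : 0 < s < 1 -> exists2 C : R, 0 < C &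
  forall (r : R) (x0 : E) (phi : E -> R), 0 < r -> measurable_fun setT phi ->
  (forall x, 0 <= phi x <= 1) ->
  (forall x y, `|phi x - phi y| <= enorm (x - y) / r) ->
  (forall x, ~ eball x0 (2 * r) x -> phi x = 0) ->
  (\int[mu \x mu]_p ((phi p.1 - phi p.2) ^+ 2 /
     enorm (p.1 - p.2) `^ (n%:R + 2 * s))%:E <= (C * r `^ (n%:R - 2 * s))%:E)%E.
Proof.
move=> s01; have /andP[P1 P4] := powR2_lt4 s01; have /andP[s0 s1] := s01.
set P : R := 2 `^ (2 * s) in P1 P4 *.
pose q := Num.max (P / 4) P^-1.
have P0 : 0 < P by lra.
have q0 : 0 < q by rewrite lt_max invr_gt0 P0 orbT.
have q1 : q < 1 by rewrite gt_max invf_lt1// P1 andbT; lra.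
pose M : R := 2 * 16 ^+ n * P.
have M0 : 0 < M by rewrite !mulr_gt0// exprn_gt0.
exists (2 * M / (1 - q)).
  by rewrite divr_gt0 ?mulr_gt0// subr_gt0.
move=> r x0 phi r0 mphi phi01 phiL phi0.
have nr s' : 0 < (r : R) `^ s' by exact: powR_gt0.
pose kk (rho : R) := ((rho / 2) `^ (n%:R + 2 * s))^-1.
have kk0 rho : 0 <= kk rho by rewrite invr_ge0 powR_ge0.
pose S rho := near_pairs x0 (2 * r) rho.
(* The first term serves the inner shells, the second one the outer shells. *)
pose F j (p : E * E) := ((2 ^+ j)^-1) ^+ 2 * kk (r / 2 ^+ j) * \1_(S (r / 2 ^+ j)) p
   + kk (r * 2 ^+ j.+1) * \1_(S (r * 2 ^+ j.+1)) p.
have mS rho : measurable (S rho) by exact: measurable_near_pairs.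
have -> : 2 * M / (1 - q) * r `^ (n%:R - 2 * s)
    = (2 * (M * r ^+ n / r `^ (2 * s))) / (1 - q).
  rewrite powRD ?(gt_eqF r0) ?implybT// powRN powR_mulrn ?ltW//.
  by field; rewrite !gt_eqF// subr_gt0.
set Mr := M * r ^+ n / r `^ (2 * s).
have Mr0 : 0 <= Mr by rewrite ltW// divr_gt0// mulr_gt0// exprn_gt0.
have two j : 0 < (2 : R) ^+ j by exact: exprn_gt0.
have c0 j : 0 <= ((2 ^+ j)^-1) ^+ 2 * kk (r / 2 ^+ j) by rewrite mulr_ge0// sqr_ge0.
apply: (@integral_le_geometric _ _ _ _ _ F).
- apply/measurable_EFinP; apply: measurable_funM; last exact: measurable_kernel.
  by apply: measurable_funX; exact: measurable_increment.
- by move=> p; rewrite lee_fin divr_ge0 ?sqr_ge0 ?powR_ge0.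
- by move=> j; apply: measurable_funD; apply: measurable_funM => //; exact: measurable_indic.
- by move=> j p; rewrite addr_ge0// mulr_ge0.
- move=> p; have [pp|/eqP pp] := eqVneq (phi p.1) (phi p.2).
    exists 0; rewrite pp subrr expr0n mul0r lee_fin addr_ge0// mulr_ge0//.
  have t0 : 0 < enorm (p.1 - p.2).
    rewrite lt_def enorm_ge0 andbT; apply/eqP => /enorm_eq0/eqP.
    by rewrite subr_eq0 => /eqP pE; apply: pp; rewrite pE.
  have pB : eball x0 (2 * r) p.1 \/ eball x0 (2 * r) p.2.
    apply: contrapT => /not_orP[h1 h2].
    by apply: pp; rewrite !phi0.
  have incr := phiL p.1 p.2.
  have incr1 : (phi p.1 - phi p.2) ^+ 2 <= 1.
    have /andP[? ?] := phi01 p.1; have /andP[? ?] := phi01 p.2.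
    by rewrite -real_normK ?num_real// exprn_ile1// ler_norml; apply/andP; split; lra.
  have kle (rho : R) : 0 < rho -> rho / 2 <= enorm (p.1 - p.2) ->
      (enorm (p.1 - p.2) `^ (n%:R + 2 * s))^-1 <= kk rho.
    move=> rho0 h; rewrite lef_pV2 ?posrE ?powR_gt0 ?divr_gt0//.
    apply: ge0_ler_powR; rewrite ?nnegrE ?(ltW t0) ?divr_ge0 ?(ltW rho0)//.
    by rewrite addr_ge0// mulr_ge0// ltW.
  have [j [/andP[t1 t2]|/andP[t1 t2]]] := dyadic_shell r0 t0; exists j; rewrite lee_fin /F.
    rewrite -[leLHS]addr0; apply: lerD; last by rewrite mulr_ge0.
    rewrite indicE mem_set /=; last by split.
    rewrite mulr1; apply: ler_pM; rewrite ?sqr_ge0 ?invr_ge0 ?powR_ge0//; last first.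
      by apply: kle => //; exact: divr_gt0.
    have h : `|phi p.1 - phi p.2| <= (2 ^+ j)^-1.
      by apply: (le_trans incr); rewrite ler_pdivrMr// mulrC ltW.
    by rewrite -real_normK ?num_real// !expr2 ler_pM.
  rewrite -[leLHS]add0r; apply: lerD; first by rewrite mulr_ge0.
  rewrite indicE mem_set /=; last by split.
  rewrite mulr1 -[leRHS]mul1r; apply: ler_pM; rewrite ?sqr_ge0 ?invr_ge0 ?powR_ge0//.
  by apply: kle => //; exact: mulr_gt0.
- move=> j; rewrite /F.
  under eq_integral do rewrite EFinD.
  rewrite ge0_integralD//; first last.
  + by apply/measurable_EFinP; apply: measurable_funM => //; exact: measurable_indic.
  + by move=> p _; rewrite lee_fin mulr_ge0.
  + by apply/measurable_EFinP; apply: measurable_funM => //; exact: measurable_indic.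
  + by move=> p _; rewrite lee_fin mulr_ge0.
  rewrite !integral_scaled_indic//.
  have muS (rho : R) : 0 < rho -> ((mu \x mu) (S rho) <=
      (2 * ((2 * (2 * r)) ^+ n * (2 * rho) ^+ n))%:E)%E.
    by move=> rho0; apply: lebesgue_near_pairs; rewrite ?mulr_ge0// ltW.
  have qn j' : 0 <= q ^+ j' by rewrite exprn_ge0// ltW.
  apply: (@le_trans _ _ ((Mr * (P / 4) ^+ j)%:E + (Mr * P^-1 ^+ j.+1)%:E)%E).
    apply: leeD.
      have cE : (0 <= (((2 ^+ j)^-1) ^+ 2 * kk (r / 2 ^+ j))%:E)%E by rewrite lee_fin.
      apply: (le_trans (lee_wpmul2l cE (muS _ (divr_gt0 r0 (two j))))).
      rewrite -EFinM lee_fin -mulrA (shell_bound s0 r0 (divr_gt0 r0 (two j))).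
      have -> : (r / 2 ^+ j) `^ (2 * s) = r `^ (2 * s) * P^-1 ^+ j.
        by rewrite powRM ?(ltW r0) ?invr_ge0 ?exprn_ge0// -exprVn powR_exprn ?invr_ge0// powR2_inv.
      rewrite le_eqVlt; apply/orP; left; apply/eqP.
      rewrite /Mr /M -/P !exprVn exprMn exprVn (_ : 4 = 2 * 2 :> R); last by ring.
      by rewrite exprMn; field; rewrite !gt_eqF ?exprn_gt0.
    have cE : (0 <= (kk (r * 2 ^+ j.+1))%:E)%E by rewrite lee_fin.
    apply: (le_trans (lee_wpmul2l cE (muS _ (mulr_gt0 r0 (two j.+1))))).
    rewrite -EFinM lee_fin (shell_bound s0 r0 (mulr_gt0 r0 (two j.+1))).
    have -> : (r * 2 ^+ j.+1) `^ (2 * s) = r `^ (2 * s) * P ^+ j.+1.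
      by rewrite powRM ?(ltW r0) ?exprn_ge0// powR_exprn.
    rewrite le_eqVlt; apply/orP; left; apply/eqP.
    by rewrite /Mr /M -/P exprVn; field; rewrite !gt_eqF ?exprn_gt0.
  rewrite -EFinD lee_fin -mulrDr.
  rewrite (_ : 2 * Mr * q ^+ j = Mr * (q ^+ j + q ^+ j)); last by ring.
  apply: ler_wpM2l => //; apply: lerD.
    by apply: lerXn2r; rewrite ?nnegrE ?(ltW q0) ?divr_ge0 ?(ltW P0)// le_max lexx.
  apply: (@le_trans _ _ (P^-1 ^+ j)).
    by rewrite exprS ler_piMl ?exprn_ge0 ?invr_ge0 ?(ltW P0)// invf_le1// ltW.
  by apply: lerXn2r; rewrite ?nnegrE ?(ltW q0) ?invr_ge0 ?(ltW P0)// le_max lexx orbT.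
- by rewrite mulr_ge0.
- by rewrite q0.
Qed.

End cutoff_energy_bound.

(** * Energies and the bilinear form *)

Section energy.
Variables (R : realType) (n : nat) (s : R).
Local Notation mu := (@lebesgue_rV R n).
Local Notation E := 'rV[R]_n.
Local Notation K p := (enorm (p.1 - p.2) `^ (n%:R + 2 * s)).
Local Notation energy u :=
  (\int[mu \x mu]_p ((u p.1 - u p.2) ^+ 2 / K p)%:E)%E.
Implicit Types u v w : E -> R.

Lemma kernel_ge0 (p : E * E) : 0 <= (K p)^-1.
Proof. by rewrite invr_ge0 powR_ge0. Qed.

Lemma measurable_energy u : measurable_fun setT u ->
  measurable_fun setT (fun p : E * E => (u p.1 - u p.2) ^+ 2 / K p).
Proof.
move=> mes_u; apply: measurable_funM; last exact: measurable_kernel.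
by apply: measurable_funX; exact: measurable_increment.
Qed.

Lemma measurable_form u v : measurable_fun setT u -> measurable_fun setT v ->
  measurable_fun setT
    (fun p : E * E => (u p.1 - u p.2) * (v p.1 - v p.2) / K p).
Proof.
move=> mes_u mv; apply: measurable_funM; last exact: measurable_kernel.
by apply: measurable_funM; exact: measurable_increment.
Qed.

Lemma energy_ge0 u (p : E * E) : 0 <= (u p.1 - u p.2) ^+ 2 / K p.
Proof. by rewrite divr_ge0 ?sqr_ge0 ?powR_ge0. Qed.

Lemma Hs_borel u : measurable_fun setT u ->
  (\int[mu]_x (u x ^+ 2)%:E < +oo)%E ->
  (energy u < +oo)%E -> Hs s u.
Proof.
by move=> mes_u u2 eu; split=> //; split=> //; exists u => //; exact: aeW.
Qed.

Lemma integrable_ge0_lty d (T : measurableType d) (m : {measure set T -> \bar R})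
    (f : T -> R) : measurable_fun setT f -> (forall x, 0 <= f x) ->
  (\int[m]_x (f x)%:E < +oo)%E -> m.-integrable setT (EFin \o f).
Proof.
move=> mf f0 fi; apply/integrableP; split; first exact/measurable_EFinP.
by under eq_integral do rewrite /= ger0_norm//.
Qed.

Lemma integrable_energy u : measurable_fun setT u ->
  (energy u < +oo)%E ->
  (mu \x mu)%E.-integrable setT
    (EFin \o (fun p : E * E => (u p.1 - u p.2) ^+ 2 / K p)).
Proof.
move=> mes_u eu; apply: integrable_ge0_lty => //; first exact: measurable_energy.
exact: energy_ge0.
Qed.

(** Both test functions get their finite energy from this comparison of increments: the
negative part of [u] from [u] alone, the logarithmic one from [u] and the cutoff. *)
Lemma energy_lty (A B : R) u w v :
  measurable_fun setT u -> measurable_fun setT w -> measurable_fun setT v ->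
  (energy u < +oo)%E ->
  (energy w < +oo)%E ->
  (forall x y, (v x - v y) ^+ 2 <= A * (u x - u y) ^+ 2 + B * (w x - w y) ^+ 2) ->
  (energy v < +oo)%E.
Proof.
move=> mes_u mw mv eu ew vuw.
have iu := integrable_energy mes_u eu.
have iw := integrable_energy mw ew.
have iAB := integrableD measurableT (integrableZl measurableT A iu)
  (integrableZl measurableT B iw).
have /integrableP[_] : (mu \x mu)%E.-integrable setT
    (EFin \o (fun p : E * E => (v p.1 - v p.2) ^+ 2 / K p)).
  apply: le_integrable iAB => //; first by apply/measurable_EFinP; exact: measurable_energy.
  move=> p _ /=; rewrite lee_fin ger0_norm ?energy_ge0//.
  apply: le_trans (ler_norm _); rewrite (mulrA A) (mulrA B) -mulrDl.
  by apply: ler_wpM2r; [exact: kernel_ge0|exact: vuw].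
by under eq_integral do rewrite /= ger0_norm ?energy_ge0//.
Qed.

Lemma integrable_form u v : measurable_fun setT u -> measurable_fun setT v ->
  (energy u < +oo)%E ->
  (energy v < +oo)%E ->
  (mu \x mu)%E.-integrable setT
    (EFin \o (fun p : E * E => (u p.1 - u p.2) * (v p.1 - v p.2) / K p)).
Proof.
move=> mes_u mv eu ev.
have iuv := integrableD measurableT (integrable_energy mes_u eu) (integrable_energy mv ev).
apply: le_integrable iuv => //; first by apply/measurable_EFinP; exact: measurable_form.
move=> p _ /=; rewrite lee_fin [leRHS]ger0_norm ?addr_ge0 ?energy_ge0//.
rewrite normrM (ger0_norm (kernel_ge0 _)) -mulrDl.
apply: ler_wpM2r; first exact: kernel_ge0.
move: (u p.1 - u p.2) (v p.1 - v p.2) => a b; rewrite ler_norml.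
have h1 : 0 <= a ^+ 2 + b ^+ 2 + 2 * (a * b).
  by rewrite (_ : _ + _ = (a + b) ^+ 2) ?sqr_ge0//; ring.
have h2 : 0 <= a ^+ 2 + b ^+ 2 - 2 * (a * b).
  by rewrite (_ : _ - _ = (a - b) ^+ 2) ?sqr_ge0//; ring.
by have := sqr_ge0 a; have := sqr_ge0 b => ? ?; apply/andP; split; lra.
Qed.

(** The form of two functions of finite energy is finite, so a pointwise bound on its
integrand may be integrated and rearranged. It is used with [W = 0] for the nonnegativity
of supersolutions, and with [W] the energy density of a cutoff for the logarithmic
estimate. *)
Lemma form_comparison u v (H W : E * E -> R) :
  measurable_fun setT u -> measurable_fun setT v ->
  (energy u < +oo)%E ->
  (energy v < +oo)%E ->
  measurable_fun setT H -> measurable_fun setT W ->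
  (forall p, 0 <= H p) -> (forall p, 0 <= W p) ->
  (\int[mu \x mu]_p (W p)%:E < +oo)%E ->
  (forall p, H p + (u p.1 - u p.2) * (v p.1 - v p.2) / K p <= W p) ->
  bilinear_form s u v \is a fin_num /\
  (\int[mu \x mu]_p (H p)%:E <= \int[mu \x mu]_p (W p)%:E - bilinear_form s u v)%E.
Proof.
move=> mes_u mv eu ev mH mW H0 W0 iW HW.
have ig := integrable_form mes_u mv eu ev.
split; first exact: (integrable_fin_num measurableT ig).
have iWI := integrable_ge0_lty mW W0 iW.
rewrite /bilinear_form -integralB_EFin//.
apply: ge0_le_integral => //.
- by move=> p _; rewrite lee_fin.
- exact/measurable_EFinP.
- apply/measurable_EFinP; apply: measurable_funB => //; exact: measurable_form.
- by move=> p _; rewrite -EFinB lee_fin lerBrDr.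
Qed.

Lemma ae_product_both (P : E -> Prop) : {ae mu, forall x, P x} ->
  {ae (mu \x mu)%E, forall p : E * E, P p.1 /\ P p.2}.
Proof.
move=> [N [mN N0 PN]].
have null1 : (mu \x mu)%E.-negligible (N `*` setT).
  apply/negligibleP; first exact: measurableX.
  apply: (eq_trans (product_measure1E mu mu mN measurableT)).
  by apply/eqP; rewrite mule_eq0; apply/orP; left; apply/eqP.
have null2 : (mu \x mu)%E.-negligible (setT `*` N).
  apply/negligibleP; first exact: measurableX.
  apply: (eq_trans (product_measure1E mu mu measurableT mN)).
  by apply/eqP; rewrite mule_eq0; apply/orP; right; apply/eqP.
apply: negligibleS (negligibleU null1 null2) => p /=.
apply: contra_notP => /not_orP[h1 h2]; split; apply: contrapT => h.
  by apply: h1; split => //; exact: PN.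
by apply: h2; split => //; exact: PN.
Qed.

(** Zero energy makes [u] almost everywhere constant. In measure-theoretic terms a
superlevel set [A] at a positive level satisfies [mu A * mu (~` A) = 0]; it has finite
measure because [u] is square integrable, so its complement, having infinite measure,
forces [mu A = 0]. *)
Lemma ae_const0 u : (0 < n)%N -> measurable_fun setT u -> (forall x, 0 <= u x) ->
  (\int[mu]_x (u x ^+ 2)%:E < +oo)%E ->
  (energy u = 0)%E ->
  {ae mu, forall x, u x = 0}.
Proof.
move=> n0 mes_u u0 u2 eu.
pose A k : set E := [set x | k.+1%:R^-1 < u x].
have mA k : measurable (A k).
  rewrite (_ : A k = u @^-1` `]k.+1%:R^-1, +oo[%classic).
    by rewrite -[X in measurable X]setTI; exact: mes_u.
  by apply/seteqP; split => x /=; rewrite in_itv/= andbT.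
have Dnull : (mu \x mu)%E.-negligible [set p : E * E | u p.1 <> u p.2].
  have mu2 : measurable_fun setT (fun p : E * E => ((u p.1 - u p.2) ^+ 2 / K p)%:E).
    by apply/measurable_EFinP; exact: measurable_energy.
  have : (\int[mu \x mu]_p `|((u p.1 - u p.2) ^+ 2 / K p)%:E| = 0)%E.
    by rewrite -[RHS]eu; apply: eq_integral => p _; rewrite /= ger0_norm ?energy_ge0.
  move/(ae_eq_integral_abs _ measurableT mu2); apply: negligibleS.
  (* The kernel only vanishes on the diagonal, where the two values agree anyway. *)
  move=> p /= up /(_ I) [] /eqP; rewrite mulf_eq0 sqrf_eq0 subr_eq0 invr_eq0 powR_eq0.
  move=> /orP[/eqP//|/andP[/eqP/enorm_eq0/eqP]]; rewrite subr_eq0 => /eqP pE.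
  by move=> _; apply: up; rewrite pE.
have Afin k : (mu (A k) < +oo)%E.
  have : ((k.+1%:R^-1 ^+ 2)%:E * mu (A k) <= \int[mu]_x (u x ^+ 2)%:E)%E.
    rewrite -integral_scaled_indic ?sqr_ge0//; apply: ge0_le_integral => //.
    - by apply/measurable_EFinP; apply: measurable_funM => //; exact: measurable_indic.
    - by apply/measurable_EFinP; exact: measurable_funX.
    move=> x _; rewrite lee_fin indicE; case: (boolP (x \in A k)) => xA /=.
      by rewrite mulr1 !expr2 ler_pM//; move: xA; rewrite inE /A/= => /ltW.
    by rewrite mulr0 sqr_ge0.
  rewrite ltNge; apply: contraTN; rewrite leye_eq => /eqP ->.
  by rewrite gt0_muley ?lte_fin ?exprn_gt0// -ltNge.
have A0 k : mu (A k) = 0%E.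
  have mC : measurable (~` A k) by exact: measurableC.
  have null : ((mu \x mu) (A k `*` ~` A k) = 0)%E.
    apply: measure_negligible; first exact: measurableX.
    apply: negligibleS Dnull => -[x y] /= [xA yA] xy.
    by apply: yA; rewrite /A/= -xy.
  have /eqP := eq_trans (esym (product_measure1E mu mu (mA k) mC)) null.
  rewrite mule_eq0 => /orP[/eqP//|/eqP CA0].
  have : (mu setT < +oo)%E.
    rewrite -(setUv (A k)); apply: le_lt_trans (measureU2 _ (mA k) mC) _.
    by apply: lte_add_pinfty; [exact: Afin|rewrite [ltLHS]CA0].
  by rewrite [ltLHS](lebesgue_rVT R n0).
have : {ae mu, forall x, forall k, ~ A k x}.
  apply: ae_foralln => k; apply/negligibleP.
    by rewrite setCK; exact: mA.
  by rewrite setCK; exact: A0.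
apply: filterS => x xA; apply/eqP; rewrite eq_le u0 andbT leNgt; apply/negP => ux.
have [k] := ltr_add_invr ux; rewrite add0r; exact: xA.
Qed.

End energy.

(** * The Lipschitz cutoff *)

Section cutoff.
Variables (R : realType) (n : nat).
Local Notation E := 'rV[R]_n.

Definition cutoff (x0 : E) (r : R) (x : E) : R :=
  Num.min 1 (Num.max 0 (2 - enorm (x - x0) / r)).

Lemma cutoff_itv x0 r x : 0 <= cutoff x0 r x <= 1.
Proof. by rewrite /cutoff le_min ler01 le_max lexx ge_min lexx. Qed.

Lemma cutoff_lipschitz x0 r x y : 0 < r ->
  `|cutoff x0 r x - cutoff x0 r y| <= enorm (x - y) / r.
Proof.
move=> r0; have : `|enorm (x - x0) / r - enorm (y - x0) / r| <= enorm (x - y) / r.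
  rewrite -mulrBl normrM (gtr0_norm (x := r^-1)) ?invr_gt0//.
  apply: ler_wpM2r; first by rewrite invr_ge0 ltW.
  have := ler_dist_enorm (x - x0) (y - x0).
  by rewrite (_ : x - x0 - (y - x0) = x - y)// opprB addrA subrK.
rewrite /cutoff; move: (enorm (x - x0) / r) (enorm (y - x0) / r) (enorm (x - y) / r) => a b c.
have m10 : Num.min 1 0 = 0 :> R by exact: min_r.
rewrite !ler_norml => /andP[h1 h2].
case: (leP 0 (2 - a)) => ha; case: (leP 0 (2 - b)) => hb;
  case: (leP 1 (2 - a)) => ha1; case: (leP 1 (2 - b)) => hb1;
  rewrite ?m10; apply/andP; split; lra.
Qed.

Lemma cutoff_out x0 r x : 0 < r -> ~ eball x0 (2 * r) x -> cutoff x0 r x = 0.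
Proof.
move=> r0 /negP; rewrite -leNgt => xr; rewrite /cutoff.
have h : 2 <= enorm (x - x0) / r by rewrite ler_pdivlMr.
by rewrite max_l ?min_r//; lra.
Qed.

Lemma cutoff_in x0 r x : 0 < r -> eball x0 r x -> cutoff x0 r x = 1.
Proof.
move=> r0; rewrite /eball/= => xr; rewrite /cutoff.
have h : enorm (x - x0) / r <= 1 by rewrite ler_pdivrMr// mul1r ltW.
by rewrite max_r ?min_l//; lra.
Qed.

Lemma measurable_cutoff x0 r : measurable_fun setT (cutoff x0 r).
Proof.
apply: measurable_minr => //; apply: measurable_maxr => //.
apply: measurable_funB => //; apply: measurable_funM => //.
exact: measurable_enormB1.
Qed.

End cutoff.

(** * Supersolutions *)

Lemma integral_le0 d (T : measurableType d) (R : realType)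
    (m : {measure set T -> \bar R}) (f : T -> R) :
  (forall x, f x <= 0) -> (\int[m]_x (f x)%:E <= 0)%E.
Proof.
move=> f0; rewrite integralE (eq_integral (cst 0%E)); last first.
  by move=> x _; rewrite funeposE max_r// lee_fin.
by rewrite integral_cst// mul0e sub0e oppe_le0 integral_ge0.
Qed.

Lemma measurable_inv_ge0 d (T : measurableType d) (R : realType) (f : T -> R) :
  measurable_fun setT f -> (forall x, 0 <= f x) ->
  measurable_fun setT (fun x => (f x)^-1).
Proof.
move=> mf f0; under eq_fun do rewrite -powR_inv1//.
exact: (measurableT_comp (measurable_powR _)).
Qed.

Section supersolution.
Variables (R : realType) (n : nat) (s : R).
Local Notation mu := (@lebesgue_rV R n).
Local Notation E := 'rV[R]_n.
Local Notation K p := (enorm (p.1 - p.2) `^ (n%:R + 2 * s)).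
Local Notation energy u :=
  (\int[mu \x mu]_p ((u p.1 - u p.2) ^+ 2 / K p)%:E)%E.
Implicit Types a u v : E -> R.

Lemma measurable_log_energy (d : R) u : measurable_fun setT u ->
  (forall x, 0 < d + u x) -> measurable_fun setT
    (fun p : E * E => ln ((d + u p.1) / (d + u p.2)) ^+ 2 / K p).
Proof.
move=> mes_u du0.
have mdu : measurable_fun setT (fun x => d + u x) by exact: measurable_funD.
apply: measurable_funM; last exact: measurable_kernel.
apply: measurable_funX; apply: (measurableT_comp (@measurable_ln R)).
apply: measurable_funM; first exact: (measurableT_comp mdu measurable_fst).
apply: measurable_inv_ge0 => [|p]; last exact: ltW.
exact: (measurableT_comp mdu measurable_snd).
Qed.

(** The two test functions used below are Borel as soon as [u] is, and restricting to Borel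
ones keeps every integrand Borel when [a] is. *)
Definition borel_supersolution a u := forall v, measurable_fun setT v ->
  Hs s v -> {ae mu, forall x, 0 <= v x} ->
  (0 <= bilinear_form s u v + \int[mu]_x (a x * u x * v x)%:E)%E.

(** Test with the negative part [v] of [u]. Both the integrand of the form, which is at most
minus the energy density of [v], and [a u v] are nonpositive; hence [v] has zero energy
and vanishes almost everywhere by [ae_const0]. *)
Lemma supersolution_ae_ge0 a u : (0 < n)%N -> (forall x, 0 <= a x) ->
  measurable_fun setT a -> measurable_fun setT u -> Hs s u ->
  borel_supersolution a u -> {ae mu, forall x, 0 <= u x}.
Proof.
move=> n0 a0 ma mes_u [[_ u2] eu] sup.
pose v x := Num.max 0 (- u x).
have v0 x : 0 <= v x by rewrite le_max lexx.
have mv : measurable_fun setT v by apply: measurable_maxr => //; exact: measurableT_comp.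
have vE x : (0 <= u x /\ v x = 0) \/ (u x <= 0 /\ v x = - u x).
  by rewrite /v; case: (leP 0 (- u x)) => ?; [right|left]; split=> //; lra.
have dv x y : (v x - v y) ^+ 2 + (u x - u y) * (v x - v y) <= 0.
  have [[? ->]|[? ->]] := vE x; have [[? ->]|[? ->]] := vE y; nra.
have dvu x y : (v x - v y) ^+ 2 <= 1 * (u x - u y) ^+ 2 + 0 * (u x - u y) ^+ 2.
  move: (dv x y); move: (u x - u y) (v x - v y) => p q pq.
  rewrite mul1r mul0r addr0 -subr_ge0.
  rewrite (_ : _ - _ = (p + q) ^+ 2 - 2 * (q ^+ 2 + p * q)); last by ring.
  by have := sqr_ge0 (p + q); lra.
have ev := energy_lty mes_u mes_u mv eu eu dvu.
have v2 : (\int[mu]_x (v x ^+ 2)%:E < +oo)%E.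
  apply: le_lt_trans u2; apply: ge0_le_integral => //.
  - by move=> x _; rewrite lee_fin sqr_ge0.
  - by apply/measurable_EFinP; exact: measurable_funX.
  - by apply/measurable_EFinP; exact: measurable_funX.
  by move=> x _; rewrite lee_fin; have [[? ->]|[? ->]] := vE x; nra.
have := sup v mv (Hs_borel mv v2 ev) (aeW _ v0).
have dvK (p : E * E) : (v p.1 - v p.2) ^+ 2 / K p +
    (u p.1 - u p.2) * (v p.1 - v p.2) / K p <= 0.
  by rewrite -mulrDl mulr_le0_ge0 ?kernel_ge0.
(* The comparison function is zero here: the form itself is at most minus the energy. *)
have I0 : (\int[mu \x mu]_p (0 : R)%:E)%E = 0%E by rewrite integral0.
have I0y : (\int[mu \x mu]_p (0 : R)%:E < +oo)%E by rewrite I0 ltry.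
have [Bfin] := form_comparison mes_u mv eu ev
  (measurable_energy _ mv) (measurable_cst (0 : R)) (energy_ge0 _ _)
  (fun=> lexx 0) I0y dvK.
rewrite I0 sub0e => Bv BI.
have B0 : (0 <= bilinear_form s u v)%E.
  apply: (le_trans BI); rewrite -[leRHS]adde0 leeD2lE//.
  apply: integral_le0 => x; rewrite -mulrA mulr_ge0_le0//.
  by have [[? ->]|[? ->]] := vE x; nra.
have v_ae0 : {ae mu, forall x, v x = 0}.
  apply: (ae_const0 (s := s)) => //; apply/eqP; rewrite eq_le; apply/andP; split.
    by apply: (le_trans Bv); rewrite oppe_le0.
  by apply: integral_ge0 => p _; rewrite lee_fin energy_ge0.
by apply: filterS v_ae0 => x vx; have [[]//|[_]] := vE x; rewrite vx; lra.
Qed.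

(** Test with [v = phi^2 / (d + u)], where [phi] is the cutoff. The increments of [u] and
[d + u] agree, so [cutoff_quotient_le] and [reciprocal_log_le] bound the squared logarithm
on the ball plus the integrand of the form by the energy density of [phi]; and
[a u v <= a phi^2] is at most [a] on the large ball and vanishes outside it. *)
Lemma log_energy_le a u (r d : R) (x0 : E) :
  (forall x, 0 <= a x) -> measurable_fun setT a ->
  (forall x, 0 <= u x) -> measurable_fun setT u -> Hs s u ->
  borel_supersolution a u -> 0 < r -> 0 < d ->
  (energy (cutoff x0 r) < +oo)%E ->
  (\int[mu \x mu]_(p in eball x0 r `*` eball x0 r)
       (`|ln ((d + u p.1) / (d + u p.2))| ^+ 2 / K p)%:E
     <= energy (cutoff x0 r) + \int[mu]_(x in eball x0 (2 * r)) (a x)%:E)%E.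
Proof.
move=> a0 ma u0 mes_u [[_ u2] eu] sup r0 d0.
have phi01 := cutoff_itv x0 r; have mphi := @measurable_cutoff R n x0 r.
have phi_in := @cutoff_in R n x0 r; have phi_out := @cutoff_out R n x0 r.
move: (cutoff x0 r) phi01 mphi phi_in phi_out => phi phi01 mphi phi_in phi_out ephi.
pose v x := phi x ^+ 2 / (d + u x).
have du0 x : 0 < d + u x by rewrite ltr_pwDl.
have v0 x : 0 <= v x by rewrite divr_ge0 ?sqr_ge0// ltW.
have mv : measurable_fun setT v.
  apply: measurable_funM; first exact: measurable_funX.
  apply: measurable_inv_ge0 => [|x]; first exact: measurable_funD.
  exact: ltW.
have ev := energy_lty mphi mes_u mv ephi eu
  (fun x y => test_increment_le d0 (phi01 x) (phi01 y) (u0 x) (u0 y)).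
have mB2 := measurable_eball x0 (2 * r).
have v2 : (\int[mu]_x (v x ^+ 2)%:E < +oo)%E.
  apply: (@le_lt_trans _ _ (\int[mu]_x (d^-1 ^+ 2 * \1_(eball x0 (2 * r)) x)%:E)%E).
    apply: ge0_le_integral => //.
    - by move=> x _; rewrite lee_fin sqr_ge0.
    - by apply/measurable_EFinP; exact: measurable_funX.
    - by apply/measurable_EFinP; apply: measurable_funM => //; exact: measurable_indic.
    move=> x _; rewrite lee_fin indicE.
    have [xB|xB] := boolP (x \in eball x0 (2 * r)); last first.
      rewrite /= mulr0 /v phi_out ?expr0n ?mul0r ?expr0n//.
      by move: xB; rewrite notin_setE.
    have vd : v x <= d^-1.
      rewrite /v -[leRHS]mul1r; have /andP[p0 p1] := phi01 x.
      apply: ler_pM; rewrite ?sqr_ge0 ?invr_ge0 ?(ltW (du0 x)) ?exprn_ile1//.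
      by rewrite lef_pV2 ?posrE// lerDl.
    by rewrite /= mulr1 !expr2 ler_pM.
  rewrite integral_scaled_indic ?sqr_ge0// lte_mul_pinfty ?lee_fin ?sqr_ge0//.
  by apply: le_lt_trans (ltry _); apply: lebesgue_eball; rewrite mulr_ge0// ltW.
have BI := sup v mv (Hs_borel mv v2 ev) (aeW _ v0).
pose B := eball x0 r `*` eball x0 r.
have mB : measurable B by apply: measurableX; exact: measurable_eball.
pose L p := \1_B p * (ln ((d + u p.1) / (d + u p.2)) ^+ 2 / K p).
have L0 p : 0 <= L p by rewrite mulr_ge0// divr_ge0 ?sqr_ge0 ?powR_ge0.
have mL : measurable_fun setT L.
  apply: measurable_funM; first exact: measurable_indic.
  exact: measurable_log_energy.
have Lphi (p : E * E) : L p + (u p.1 - u p.2) * (v p.1 - v p.2) / K p <=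
    (phi p.1 - phi p.2) ^+ 2 / K p.
  rewrite /L mulrA -mulrDl; apply: ler_wpM2r; first exact: kernel_ge0.
  rewrite indicE; case: (boolP (p \in B)) => pB /=; last first.
    rewrite mul0r add0r (_ : u p.1 - u p.2 = d + u p.1 - (d + u p.2)); last by ring.
    exact: cutoff_quotient_le.
  move: pB; rewrite inE => -[/= p1 p2].
  have := reciprocal_log_le (du0 p.1) (du0 p.2).
  rewrite (_ : d + u p.1 - (d + u p.2) = u p.1 - u p.2); last by ring.
  by rewrite /v !phi_in// !expr1n !mul1r subrr expr0n /=; lra.
have [Bfin LB] := form_comparison mes_u mv eu ev mL
  (measurable_energy _ mphi) L0 (energy_ge0 _ _) ephi Lphi.
have -> : (\int[mu \x mu]_(p in B)
       (`|ln ((d + u p.1) / (d + u p.2))| ^+ 2 / K p)%:E)%E =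
   (\int[mu \x mu]_p (L p)%:E)%E.
  rewrite integral_mkcond; apply: eq_integral => p _.
  rewrite patchE /L indicE; case: ifP => pB /=; last by rewrite mul0r.
  by rewrite mul1r real_normK ?num_real.
apply: (le_trans LB); apply: leeD => //.
apply: (@le_trans _ _ (\int[mu]_x (a x * u x * v x)%:E)%E).
  by rewrite -sub0e leeBlDl.
rewrite [leRHS]integral_mkcond.
have auv0 x : 0 <= a x * u x * v x by apply: mulr_ge0 => //; exact: mulr_ge0.
apply: ge0_le_integral => //.
- by move=> x _; rewrite lee_fin.
- by apply/measurable_EFinP; apply: measurable_funM => //; exact: measurable_funM.
- apply/(measurable_restrictT _ _).1 => //; apply: measurable_funTS.
  exact/measurable_EFinP.
move=> x _; rewrite patchE; case: ifPn => xB; last first.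
  rewrite lee_fin /v phi_out ?expr0n ?mul0r ?mulr0//.
  by move: xB; rewrite notin_setE.
rewrite lee_fin -[leRHS]mulr1 -mulrA ler_wpM2l//.
rewrite /v mulrA ler_pdivrMr// mul1r; have /andP[p0 p1] := phi01 x.
have : phi x ^+ 2 <= 1 by rewrite exprn_ile1.
by have := u0 x; nra.
Qed.

End supersolution.

Lemma supersolution_borel (R : realType) (n : nat) (s : R)
    (a u b w : 'rV[R]_n -> R) :
  measurable_fun setT b -> measurable_fun setT w ->
  {ae lebesgue_rV n, forall x, a x = b x} ->
  {ae lebesgue_rV n, forall x, u x = w x} ->
  (forall v : 'rV[R]_n -> R, Hs s v ->
     {ae lebesgue_rV n, forall x, 0 <= v x} ->
     integral_well_defined (fun x => (a x * u x * v x)%:E) /\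
     (0 <= bilinear_form s u v +
             \int[lebesgue_rV n]_x (a x * u x * v x)%:E)%E) ->
  borel_supersolution s b w.
Proof.
move=> mb mw ab uw sup v mv Hv v0; have [_] := sup v Hv v0.
rewrite /bilinear_form (integral_ae_measurable (g := fun p =>
  ((w p.1 - w p.2) * (v p.1 - v p.2) / enorm (p.1 - p.2) `^ (n%:R + 2 * s))%:E))//.
- rewrite (integral_ae_measurable (g := fun x => (b x * w x * v x)%:E))//.
    by apply/measurable_EFinP; apply: measurable_funM => //; exact: measurable_funM.
  by apply: filterS2 ab uw => x -> -> _.
- by apply/measurable_EFinP; exact: measurable_form.
- by apply: filterS (ae_product_both uw) => p [-> ->] _.
Qed.

Lemma Hs_ae (R : realType) (n : nat) (s : R) (u w : 'rV[R]_n -> R) :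
  measurable_fun setT w -> {ae lebesgue_rV n, forall x, u x = w x} ->
  Hs s u -> Hs s w.
Proof.
move=> mw uw [[_ u2] eu]; apply: Hs_borel => //.
  rewrite -(integral_ae_measurable (f := fun x => (u x ^+ 2)%:E))//.
    by apply/measurable_EFinP; exact: measurable_funX.
  by apply: filterS uw => x -> _.
rewrite -(integral_ae_measurable (f := fun p => ((u p.1 - u p.2) ^+ 2 /
  enorm (p.1 - p.2) `^ (n%:R + 2 * s))%:E))//.
  by apply/measurable_EFinP; exact: measurable_energy.
by apply: filterS (ae_product_both uw) => p [-> ->] _.
Qed.

Theorem lemma4p3 (R : realType) (n : nat) (s : R) :
  (1 <= n)%N -> 0 < s < 1 ->
  exists2 C : R, 0 < C &
  forall a u : 'rV[R]_n -> R,
    (forall x, 0 <= a x) -> L1loc a -> Hs s u ->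
    (forall v : 'rV[R]_n -> R, Hs s v ->
       {ae lebesgue_rV n, forall x, 0 <= v x} ->
       integral_well_defined (fun x => (a x * u x * v x)%:E) /\
       (0 <= bilinear_form s u v +
             \int[lebesgue_rV n]_x (a x * u x * v x)%:E)%E) ->
  forall (r d : R) (x0 : 'rV[R]_n), 0 < r -> 0 < d ->
    (\int[lebesgue_rV n \x lebesgue_rV n]_(p in eball x0 r `*` eball x0 r)
       (`|ln ((d + u p.1) / (d + u p.2))| ^+ 2 /
        enorm (p.1 - p.2) `^ (n%:R + 2 * s))%:E
     <= (C * r `^ (n%:R - 2 * s))%:E +
        \int[lebesgue_rV n]_(x in eball x0 (2 * r)) (a x)%:E)%E.
Proof.
move=> n1 s01; have [C C0 cutoffC] := @cutoff_energy R n s s01.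
exists C => // a u a0 [[b0 mb0 ab0] _] Hu sup r d x0 r0 d0.
have [[[w0 mw0 uw0] _] _] := Hu.
pose b x := Num.max 0 (b0 x).
have mb : measurable_fun setT b by exact: measurable_maxr.
have b_ge0 x : 0 <= b x by rewrite le_max lexx.
have ab : {ae lebesgue_rV n, forall x, a x = b x}.
  by apply: filterS ab0 => x abx; rewrite /b -abx max_r.
have w0_ge0 := supersolution_ae_ge0 n1 b_ge0 mb mw0 (Hs_ae mw0 uw0 Hu)
  (supersolution_borel mb mw0 ab uw0 sup).
(* Nonnegativity at every point keeps [d + w] positive everywhere. *)
pose w x := Num.max 0 (w0 x).
have mw : measurable_fun setT w by exact: measurable_maxr.
have w_ge0 x : 0 <= w x by rewrite le_max lexx.
have uw : {ae lebesgue_rV n, forall x, u x = w x}.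
  by apply: filterS2 uw0 w0_ge0 => x -> w0x; rewrite /w max_r.
have ephi := cutoffC r x0 _ r0 (measurable_cutoff x0 r) (cutoff_itv x0 r)
  (fun x y => cutoff_lipschitz x0 x y r0) (fun x => cutoff_out r0).
have := log_energy_le b_ge0 mb w_ge0 mw (Hs_ae mw uw Hu)
  (supersolution_borel mb mw ab uw sup) r0 d0 (le_lt_trans ephi (ltry _)).
move/le_trans => /(_ _ (leeD2r _ ephi)).
rewrite -(integral_ae_measurable (f := fun x => (a x)%:E)); last 3 first.
- exact: measurable_eball.
- by apply: measurable_funTS; apply/measurable_EFinP.
- by apply: filterS ab => x -> _.
congr (_ <= _)%E; symmetry; apply: integral_ae_measurable.
- by apply: measurableX; exact: measurable_eball.
- apply: measurable_funTS; apply/measurable_EFinP.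
  under eq_fun do rewrite real_normK ?num_real//.
  by apply: measurable_log_energy => // x; exact: ltr_pwDl.
- by apply: filterS (ae_product_both uw) => p [-> ->] _.
Qed.
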